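(* The data $X$ are informative for stability (i.e. every $A\in\Sigma_{\mathrm{s}}$ is stable) if and only if $X_-$ has full row rank and $X_+X_-^\dagger$ is stable for any right inverse $X_-^\dagger$ of $X_-$; equivalently, if and only if $\Sigma_{\mathrm{s}}=\{A_s\}$ and $A_s=X_+X_-^\dagger$ is stable.
   Context: Fix positive integers $n,q,T_1,\dots,T_q$. Let $A_s\in\mathbb{R}^{n\times n}$ define the 'true' autonomous system $x(t+1)=A_sx(t)$. For $i=1,\dots,q$ let $x^i(0),\dots,x^i(T_i)\in\mathbb{R}^n$ be state data generated by it: $x^i(t+1)=A_sx^i(t)$ for $t=0,\dots,T_i-1$. Put $X^i=[x^i(0)\ \cdots\ x^i(T_i)]$, $X^i_-=[x^i(0)\ \cdots\ x^i(T_i-1)]$, $X^i_+=[x^i(1)\ \cdots\ x^i(T_i)]$ and $X=[X^1\ \cdots\ X^q]$, $X_-=[X^1_-\ \cdots\ X^q_-]$, $X_+=[X^1_+\ \cdots\ X^q_+]$; thus $X_+=A_sX_-$. The set of autonomous systems consistent with the data is $\Sigma_{\mathrm{s}}=\{A\in\mathbb{R}^{n\times n}\mid X_+=AX_-\}$. A square matrix is called stable if all its eigenvalues lie in the open unit disk. A right inverse of $X_-$ is a real matrix $X_-^\dagger$ with $X_-X_-^\dagger=I$. *)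

(* Defs.v *)
From HB Require Import structures.
From mathcomp Require Import all_boot all_order all_algebra.
From mathcomp Require Import classical_sets reals complex.

Set Implicit Arguments.
Unset Strict Implicit.
Unset Printing Implicit Defensive.

Import Order.TTheory GRing.Theory Num.Theory.
Local Open Scope classical_set_scope.
Local Open Scope ring_scope.
Local Open Scope complex_scope.

(* The modulus of [l : R[i]] is itself an element of R[i], so that [`|l| < 1]
   is the order of R[i], which compares real numbers as usual. *)
Definition stable (R : realType) (n : nat) (A : 'M[R]_n) : Prop :=
  forall l : R[i], eigenvalue (map_mx (real_complex R) A) l -> `|l| < 1.

Definition is_right_inverse (R : realType) (m p : nat)
    (M : 'M[R]_(m, p)) (D : 'M[R]_(p, m)) : Prop := M *m D = 1%:M.

(* Trajectory i consists of the (T i).+1 samples x i 0, ..., x i (T i). *)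
Definition state_data (R : realType) (n q : nat) (T : 'I_q -> nat) : Type :=
  forall i : 'I_q, 'I_(T i).+1 -> 'cV[R]_n.

Section Data.
Variables (R : realType) (n q : nat) (T : 'I_q -> nat).
Variable x : state_data R n T.

(* [state i t] and [succ_state i t] are x^i(t) and x^i(t+1), for t < T i. *)
Definition state (i : 'I_q) (t : 'I_(T i)) : 'cV[R]_n :=
  x (widen_ord (leqnSn (T i)) t).
Definition succ_state (i : 'I_q) (t : 'I_(T i)) : 'cV[R]_n := x (lift ord0 t).

Definition Xminus : 'M[R]_(n, \sum_(i < q) T i) :=
  \mxrow_(i < q) \matrix_(r < n, t < T i) state t r 0.
Definition Xplus : 'M[R]_(n, \sum_(i < q) T i) :=
  \mxrow_(i < q) \matrix_(r < n, t < T i) succ_state t r 0.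

Definition generated_by (A : 'M[R]_n) : Prop :=
  forall (i : 'I_q) (t : 'I_(T i)), succ_state t = A *m state t.

Definition Sigma_s : set 'M[R]_n := [set A | Xplus = A *m Xminus].

Definition informative_for_stability : Prop :=
  forall A : 'M[R]_n, Sigma_s A -> stable A.

End Data.

(* Main.v *)
Require Import Defs.
From HB Require Import structures.
From mathcomp Require Import all_boot all_order all_algebra.
From mathcomp Require Import classical_sets reals complex.

Set Implicit Arguments.
Unset Strict Implicit.
Unset Printing Implicit Defensive.

Import Order.TTheory GRing.Theory Num.Theory.
Local Open Scope classical_set_scope.
Local Open Scope ring_scope.

(** The data come from [As], so [Sigma_s] is [As] plus all matrices that annihilate [Xminus] from
    the left. With full row rank only [As] remains, and [Xplus *m D = As *m Xminus *m D = As] for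
    every right inverse [D], so both criteria reduce to stability of [As]. Without it, a rank-one
    perturbation of [As] stays consistent with the data and has eigenvalue 1, so informativity fails
    ([informative_row_free]). *)

Lemma fixed_vector_not_stable (R : realType) (n : nat) (A : 'M[R]_n)
    (u : 'cV[R]_n) : u != 0 -> A *m u = u -> ~ stable A.
Proof.
move=> u0 Au; suff ev1 : eigenvalue (map_mx (real_complex R) A) 1.
  by move=> /(_ 1 ev1); rewrite normr1 ltxx.
(* [eigenvalue] is about row vectors while [u] is a column. Singularity of [A - 1] bridges the two
   sides, and it descends from [R[i]] to [R]. *)
rewrite /eigenvalue kermx_eq0 row_free_unit -(map_mx1 (real_complex R)) -map_mxB.
rewrite map_unitmx; apply: contra u0 => uA.
by rewrite -(mulKmx uA u) mulmxBl mul1mx Au subrr mulmx0.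
Qed.

Lemma Sigma_s_generator (R : realType) (n q : nat) (T : 'I_q -> nat)
    (As : 'M[R]_n) (x : state_data R n T) :
  generated_by x As -> Sigma_s x As.
Proof.
move=> hx; rewrite /Sigma_s /= /Xplus /Xminus mul_mxrow.
apply: eq_mxrow => i; apply/matrixP => r t; rewrite !mxE hx mxE.
by apply: eq_bigr => k _; rewrite mxE.
Qed.

(* If w != 0 and w *m X_- = 0, choose u with w *m u = 1: the matrix
   As + (1 - As) u w agrees with As on X_- but fixes u. *)
Lemma informative_row_free (R : realType) (n q : nat) (T : 'I_q -> nat)
    (As : 'M[R]_n) (x : state_data R n T) :
  Sigma_s x As -> informative_for_stability x -> row_free (Xminus x).
Proof.
move=> sAs inf; rewrite -kermx_eq0; apply/negPn/negP => ker_neq0.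
set w := nz_row (kermx (Xminus x)).
have w0 : w != 0 by rewrite nz_row_eq0.
have wX : w *m Xminus x = 0 by apply/sub_kermxP; exact: nz_row_sub.
have /row_freeP[u wu] : row_free w by rewrite /row_free rank_rV w0.
have u0 : u != 0.
  by apply: contra_eq_neq wu => ->; rewrite mulmx0 eq_sym oner_neq0.
apply: (fixed_vector_not_stable (A := As + (1%:M - As) *m u *m w) u0).
  rewrite [LHS]mulmxDl -[_ *m w *m u]mulmxA wu mulmx1.
  by rewrite mulmxBl mul1mx addrC subrK.
apply: inf; rewrite /Sigma_s /=.
by rewrite [RHS]mulmxDl -[_ *m w *m _]mulmxA wX mulmx0 addr0.
Qed.

Theorem corollary11 (R : realType) (n q : nat) (T : 'I_q -> nat)
    (hn : (0 < n)%N) (hq : (0 < q)%N) (hT : forall i : 'I_q, (0 < T i)%N)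
    (As : 'M[R]_n) (x : state_data R n T) (hx : generated_by x As) :
  (informative_for_stability x <->
     row_free (Xminus x) /\
     (forall D : 'M[R]_(\sum_(i < q) T i, n),
        is_right_inverse (Xminus x) D -> stable (Xplus x *m D))) /\
  (informative_for_stability x <->
     Sigma_s x = [set As] /\
     (exists D : 'M[R]_(\sum_(i < q) T i, n), is_right_inverse (Xminus x) D) /\
     (forall D : 'M[R]_(\sum_(i < q) T i, n),
        is_right_inverse (Xminus x) D -> As = Xplus x *m D) /\
     stable As).
Proof.
have sAs := Sigma_s_generator hx.
have XD D : is_right_inverse (Xminus x) D -> Xplus x *m D = As.
  by move=> XmD; rewrite sAs -mulmxA XmD mulmx1.
(* Full row rank makes right multiplication by [Xminus x] injective. *)
have SigmaE : row_free (Xminus x) -> Sigma_s x = [set As].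
  move=> fX; apply/seteqP; split=> A /=; last by move->.
  by move=> sA; apply: (row_free_inj fX); rewrite -sA.
split; split.
- move=> inf; split; first exact: informative_row_free sAs inf.
  by move=> D /XD->; exact: inf.
- move=> [fX stD] A; rewrite SigmaE // => ->.
  (* Full row rank provides a right inverse to which [stD] applies. *)
  by have /row_freeP[D XmD] := fX; rewrite -(XD D XmD); exact: stD.
- move=> inf; have fX := informative_row_free sAs inf.
  split; first exact: SigmaE.
  split; first by have /row_freeP := fX.
  by split=> [D /XD//|]; exact: inf.
- by move=> [SE [_ [_ stAs]]] A; rewrite SE => ->.
Qed.
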